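(* A complete SD-DEF1 matching is not guaranteed to exist. That is, there exists a two-sided matching instance (consisting of sizes $n^\ell,n^r$, common degree constraints $d^\ell,d^r$ with $n^\ell d^\ell=n^r d^r$, $d^\ell\le n^r$, $d^r\le n^\ell$, and a preference ranking for every agent over the agents of the opposite side) that admits no complete SD-DEF1 matching.
   Context: Write $[n]=\{0,\ldots,n-1\}$. There are two disjoint groups of agents, $N^\ell=[n^\ell]$ (left) and $N^r=[n^r]$ (right). Every left agent has degree constraint $d^\ell\ge 1$ and every right agent has degree constraint $d^r\ge 1$. A (valid) matching is a binary $n^\ell\times n^r$ matrix $M$ in which every row sum is at most $d^\ell$ and every column sum is at most $d^r$; agents $i\in N^\ell$ and $j\in N^r$ are matched iff $M(i,j)=1$. The matching $M$ is complete if its total number of ones is $\min(n^\ell d^\ell,\,n^r d^r)$. Each left agent $i$ has a preference ranking $\sigma^\ell_i$ (a linear order over $N^r$) and each right agent $j$ has a preference ranking $\sigma^r_j$ (a linear order over $N^\ell$); $\sigma^\ell_i(p)$ and $\sigma^r_j(p)$ denote the agent in position $p$ of the ranking, position $0$ being the most preferred. SD-EF1: $M$ is SD-EF1 over $N^\ell$ if for all $i,i'\in N^\ell$ and all $t\in[n^r]$, $\sum_{p=0}^t M(i,\sigma^\ell_i(p))\ge \sum_{p=0}^t M(i',\sigma^\ell_i(p))-1$. It is SD-EF1 over $N^r$ if for all $j,j'\in N^r$ and all $t\in[n^\ell]$, $\sum_{p=0}^t M(\sigma^r_j(p),j)\ge \sum_{p=0}^t M(\sigma^r_j(p),j')-1$.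 $M$ is SD-DEF1 if it is SD-EF1 over both $N^\ell$ and $N^r$. *)

(* Defs.v *)
From mathcomp Require Import all_boot all_fingroup all_algebra.

Set Implicit Arguments.
Unset Strict Implicit.
Unset Printing Implicit Defensive.

(* A ranking (linear order on the opposite side) is a permutation from positions
   to agents: [sl i p] is the right agent that left agent [i] places in position
   [p], position 0 being the most preferred; dually for [sr]. *)

Section Matching.
Variables nl nr : nat.
Implicit Types (M : 'M[bool]_(nl, nr)).

Definition matching (dl dr : nat) M : Prop :=
  (forall i : 'I_nl, \sum_(j < nr) M i j <= dl) /\
  (forall j : 'I_nr, \sum_(i < nl) M i j <= dr).

Definition complete (dl dr : nat) M : Prop :=
  \sum_(i < nl) \sum_(j < nr) M i j = minn (nl * dl) (nr * dr).

(* The "- 1" of SD-EF1 is moved to the other side of the inequality, which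
   avoids truncated subtraction. *)
Definition sd_ef1_left (sl : 'I_nl -> {perm 'I_nr}) M : Prop :=
  forall (i i' : 'I_nl) (t : 'I_nr),
    \sum_(p < nr | p <= t) M i' (sl i p)
      <= \sum_(p < nr | p <= t) M i (sl i p) + 1.

Definition sd_ef1_right (sr : 'I_nr -> {perm 'I_nl}) M : Prop :=
  forall (j j' : 'I_nr) (t : 'I_nl),
    \sum_(p < nl | p <= t) M (sr j p) j'
      <= \sum_(p < nl | p <= t) M (sr j p) j + 1.

Definition sd_def1 (sl : 'I_nl -> {perm 'I_nr}) (sr : 'I_nr -> {perm 'I_nl})
    M : Prop :=
  sd_ef1_left sl M /\ sd_ef1_right sr M.

End Matching.

(* Main.v *)
Require Import Defs.
From mathcomp Require Import all_boot all_fingroup all_algebra.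
From mathcomp Require Import zify.

(** Six left agents with a common ranking 0, ..., 9 face ten right agents, with
    [dl = 5] and [dr = 3].  The common ranking forces every left agent to be
    matched to exactly one of the right agents [2m] and [2m+1], so these two have
    complementary columns; they also share a ranking [r_m].  Mutual EF1 between
    [0] and [1] under [r_0 = 0 1 2 3 4 5] makes column 0 contain exactly one of
    each pair [{0,1}], [{2,3}], [{4,5}], i.e. it is a truth assignment in which 1,
    3, 5 are the negations of 0, 2, 4.  For [m > 0], one of [2m], [2m+1] has at
    most one of the three top agents of [r_m], so neither column 0 nor its
    complement contains all three: column 0 satisfies a not-all-equal clause.  The
    top triples [024], [025], [034], [124] of [r_1], ..., [r_4] give an
    unsatisfiable not-all-equal formula. *)

Lemma sum_prefix_inord {n : nat} (f : 'I_n.+1 -> nat) (t : nat) : t <= n ->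
  \sum_(p < n.+1 | p <= t) f p = \sum_(0 <= p < t.+1) f (inord p).
Proof.
move=> le_tn; rewrite (big_nat_widen _ _ n.+1) // big_mkord.
by apply: eq_bigr => p _; rewrite inord_val.
Qed.

(** A value below [c] caps all the others at [c], so the total falls short of [n * c]; a value above
    [c] is symmetric. *)
Lemma sum_near_equal {n : nat} (f : 'I_n -> nat) (c : nat) :
  (forall i i', f i' <= f i + 1) -> \sum_(i < n) f i = n * c ->
  forall i, f i = c.
Proof.
move=> near sum_f i; move: sum_f.
have ->: n * c = \sum_(k < n) c by rewrite sum_nat_const card_ord.
rewrite (bigD1 i) //= [RHS](bigD1 i) //= => sum_f.
have [lt_fc|lt_cf|//] := ltngtP (f i) c.
- suff : \sum_(k < n | k != i) f k <= \sum_(k < n | k != i) c.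
    by rewrite -(leq_add2l (f i)) sum_f leq_add2r leqNgt lt_fc.
  by apply: leq_sum => k _; have := near i k; lia.
- suff : \sum_(k < n | k != i) c <= \sum_(k < n | k != i) f k.
    by rewrite -(leq_add2l c) -sum_f leq_add2r leqNgt lt_cf.
  by apply: leq_sum => k _; have := near k i; lia.
Qed.

Lemma complete_col_sum {nl nr dl dr : nat} {M : 'M[bool]_(nl, nr)} :
  nl * dl = nr * dr -> matching dl dr M -> complete dl dr M ->
  forall j, \sum_(i < nl) M i j = dr.
Proof.
rewrite /complete => -> [_ le_col]; rewrite minnn exchange_big => total j.
have sum_dr : nr * dr = \sum_(k < nr) dr by rewrite sum_nat_const card_ord.
have := leqif_sum (P := xpredT) (fun k _ => leqif_eq (le_col k)).
by case=> _; rewrite total sum_dr eqxx => /esym /forallP /(_ j) /eqP.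
Qed.

(** Under a common ranking, EF1 compares the same prefix in all rows, so its row sums differ by at
    most 1; they total [t * dr], a multiple of [nl], and [sum_near_equal] applies. *)
Lemma identical_prefix_sum {nl nr dr : nat} {M : 'M[bool]_(nl, nr.+1)} :
  sd_ef1_left (fun=> 1%g) M -> (forall j, \sum_(i < nl) M i j = dr) ->
  forall t c, t <= nr.+1 -> t * dr = nl * c ->
  forall i, \sum_(0 <= p < t) M i (inord p) = c.
Proof.
move=> ef1 col [|t] c le_t eq_c.
  by move=> i; rewrite big_geq //; have := ltn_ord i; nia.
apply: sum_near_equal => [i i'|].
  have := ef1 i i' (inord t); rewrite inordK //.
  rewrite !sum_prefix_inord //.
  by under eq_bigr do rewrite perm1; under [in X in _ <= X -> _]eq_bigr do rewrite perm1.
rewrite exchange_big -eq_c.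
by under eq_bigr do rewrite col; rewrite sum_nat_const_nat subn0.
Qed.

(** A sigma type, so that [sval] can extract the ranking as data. *)
Lemma ranking_of_seq (n : nat) (s : seq nat) : perm_eq s (iota 0 n.+1) ->
  {r : {perm 'I_n.+1} | forall i, i <= n -> r (inord i) = inord (nth 0 s i)}.
Proof.
move=> s_iota; have size_s : size s = n.+1.
  by rewrite (perm_size s_iota) size_iota.
have s_lt i : i < n.+1 -> nth 0 s i < n.+1.
  move=> lt_in; have : nth 0 s i \in s by rewrite mem_nth // size_s.
  by rewrite (perm_mem s_iota) mem_iota.
have inj : injective (fun i : 'I_n.+1 => inord (nth 0 s i) : 'I_n.+1).
  move=> i j /(congr1 val) /=; rewrite !inordK ?s_lt // => /eqP.
  by rewrite nth_uniq ?size_s // ?(perm_uniq s_iota) ?iota_uniq // => /eqP /val_inj.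
by exists (perm inj) => i le_in; rewrite permE inordK.
Qed.

Definition orders : seq (seq nat) :=
  [:: [:: 0; 1; 2; 3; 4; 5]; [:: 0; 2; 4; 1; 3; 5]; [:: 0; 2; 5; 1; 3; 4];
      [:: 0; 3; 4; 1; 2; 5]; [:: 1; 2; 4; 0; 3; 5]].

Lemma order_perm (m : nat) : m < 5 -> perm_eq (nth [::] orders m) (iota 0 6).
Proof. by case: m => [|[|[|[|[|]]]]]. Qed.

Theorem theorem1 :
  exists (nl nr dl dr : nat)
         (sl : 'I_nl -> {perm 'I_nr}) (sr : 'I_nr -> {perm 'I_nl}),
    [/\ 1 <= dl, 1 <= dr, nl * dl = nr * dr, dl <= nr & dr <= nl] /\
    ~ (exists M : 'M[bool]_(nl, nr),
         [/\ matching dl dr M, complete dl dr M & sd_def1 sl sr M]).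
Proof.
have half_lt (j : 'I_10) : j./2 < 5 by have := ltn_ord j; lia.
pose sr j := sval (ranking_of_seq _ _ (order_perm _ (half_lt j))).
exists 6, 10, 5, 3, (fun=> 1%g), sr; split=> // -[M [valid compl [efl efr]]].
have col := complete_col_sum (erefl : 6 * 5 = 10 * 3) valid compl.
pose x i j := nat_of_bool (M (inord i) (inord j)).
have pair i m : m < 5 -> x i m.*2 + x i m.*2.+1 = 1.
  move=> lt_m.
  (* Here [t.*2 * 3 = 6 * t]; consecutive prefixes then differ by one match. *)
  have prefix t : t <= 5 -> \sum_(0 <= p < t.*2) x i p = t.
    by move=> le_t; apply: (identical_prefix_sum efl col); lia.
  by have := prefix m.+1 lt_m; rewrite doubleS !big_nat_recr //= prefix; lia.
have env j j' t (y := nth 0 (nth [::] orders j./2)) :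
    j < 10 -> j' < 10 -> t < 6 ->
    \sum_(0 <= p < t.+1) x (y p) j' <= \sum_(0 <= p < t.+1) x (y p) j + 1.
  move=> lt_j lt_j' lt_t; have := efr (inord j) (inord j') (inord t).
  rewrite inordK // !sum_prefix_inord //.
  have sumE k : \sum_(0 <= p < t.+1) M (sr (inord j) (inord p)) k
      = \sum_(0 <= p < t.+1) M (inord (y p)) k.
    apply: eq_big_nat => p /andP[_ lt_p]; rewrite /sr (svalP (ranking_of_seq _ _ _)).
      by rewrite inordK.
    lia.
  by rewrite !sumE.
have split01 t : t < 6 ->
  \sum_(0 <= p < t.+1) x p 0 <= \sum_(0 <= p < t.+1) x p 1 + 1 /\
  \sum_(0 <= p < t.+1) x p 1 <= \sum_(0 <= p < t.+1) x p 0 + 1.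
  move=> lt_t; have ordE p : p < t.+1 -> nth 0 (nth [::] orders 0) p = p.
    by move=> lt_p; apply: (nth_iota 0 0 (n := 6)); lia.
  have sumE k : \sum_(0 <= p < t.+1) x (nth 0 (nth [::] orders 0) p) k
      = \sum_(0 <= p < t.+1) x p k.
    by apply: eq_big_nat => p /andP[_ lt_p]; rewrite ordE.
  by have := env 0 1 t isT isT lt_t; have := env 1 0 t isT isT lt_t; rewrite /= !sumE.
have nae m (y := nth 0 (nth [::] orders m)) : m < 5 ->
    1 <= x (y 0) 0 + x (y 1) 0 + x (y 2) 0 <= 2.
  move=> lt_m.
  (* If column [k] held all three top agents, EF1 would give [m.*2] and [m.*2.+1] at least two each,
     but by [pair] they share only three. *)
  have le2 k : k < 2 -> x (y 0) k + x (y 1) k + x (y 2) k <= 2.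
    move=> lt_k; have lt_k10 : k < 10 by lia.
    have lt_j : m.*2 < 10 by lia.
    have lt_j' : m.*2.+1 < 10 by lia.
    have := env m.*2 k 2 lt_j lt_k10 isT; have := env m.*2.+1 k 2 lt_j' lt_k10 isT.
    rewrite /= uphalf_double doubleK -/y !big_nat_recr //= !big_geq //.
    have := (pair (y 0) m lt_m, pair (y 1) m lt_m, pair (y 2) m lt_m).
    by case=> -[]; lia.
  (* The bound on column 1, the complement of column 0, is the lower bound on column 0. *)
  have := (le2 0 isT, le2 1 isT, pair (y 0) 0 isT, pair (y 1) 0 isT, pair (y 2) 0 isT).
  by case=> -[[[]]] /=; rewrite ?double0; lia.
(* On the first 2, 4 and 6 agents, columns 0 and 1 have an even total and differ by at most 1, so
   they agree. *)
have [] := split01 1 isT; have [] := split01 3 isT; have [] := split01 5 isT.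
have /= := nae 1 isT; have /= := nae 2 isT; have /= := nae 3 isT; have /= := nae 4 isT.
rewrite !big_nat_recr //= !big_geq //.
have := fun i => pair i 0 isT; rewrite double0 => c.
have := (c 0, c 1, c 2, c 3, c 4, c 5); do 5!case; lia.
Qed.
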